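(* Let $n\ge 3$ be an integer, let $q$ be a prime number with $q\ge 2n-1$, let $R=\mathbb{F}_q$, and let $N:R\to\{0,1,\dots,q-1\}$ be the bijection given by $N(\overline{i})=i$ for all $0\le i\le q-1$, where $\overline{i}$ is the residue class of $i$. For $m\ge 1$ define $N_m:R^m\to\{1,\dots,q^m\}$ by $N_m(a_1,\dots,a_m)=1+\sum_{j=1}^m q^{j-1}N(a_j)$. Let $A$ be the $2n\times n$ matrix over $R$ with $A_{i,j}=(i-1)^{j-1}$ for $1\le i\le 2n-1$, $1\le j\le n$ (with $0^0=1$), $A_{2n,j}=0$ for $1\le j\le n-1$ and $A_{2n,n}=1$. Write $A=\begin{pmatrix}P\\ Q\end{pmatrix}$ with $P,Q$ of size $n\times n$, let $B=\begin{pmatrix}2P\\ -2Q\end{pmatrix}$, and let $X=(A\ B)$, a $2n\times 2n$ matrix over $R$. Then for each $t\in R^{2n}$ the $q^n\times q^n$ matrix $M$ defined by $$M_{N_n(a),N_n(b)}=N_{2n}\left(X\begin{pmatrix}a\\ b\end{pmatrix}+t\right),\qquad a,b\in R^n,$$ is a normal $n$-multimagic square.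
   Context: An $m\times m$ matrix of natural numbers is a magic square if the sums of the elements in each row, in each column and in each of the two main diagonals (entries $(i,i)$, and entries $(i,m+1-i)$) are all equal to the same number. For a matrix $M$, $M^{*d}$ denotes the matrix obtained by raising each entry to the $d$-th power. $M$ is an $n$-multimagic square if $M^{*d}$ is a magic square for every $d=1,2,\dots,n$. An $m\times m$ matrix is normal if its entries are the integers $1,2,\dots,m^2$, each occurring exactly once. *)

(* Defs.v *)
From mathcomp Require Import all_boot all_order all_algebra.

Set Implicit Arguments.
Unset Strict Implicit.
Unset Printing Implicit Defensive.

Import GRing.Theory.
Local Open Scope ring_scope.

Definition magic_square (m : nat) (M : 'M[nat]_m) : Prop :=
  exists s : nat,
    [/\ forall i : 'I_m, (\sum_(j < m) M i j)%N = s,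
        forall j : 'I_m, (\sum_(i < m) M i j)%N = s,
        (\sum_(i < m) M i i)%N = s
      & (\sum_(i < m) M i (rev_ord i))%N = s].

Definition entrywise_power (m d : nat) (M : 'M[nat]_m) : 'M[nat]_m :=
  map_mx (fun x : nat => (x ^ d)%N) M.

Definition multimagic_square (n m : nat) (M : 'M[nat]_m) : Prop :=
  forall d : nat, (1 <= d <= n)%N -> magic_square (entrywise_power d M).

Definition normal_matrix (m : nat) (M : 'M[nat]_m) : Prop :=
  perm_eq [seq M p.1 p.2 | p : 'I_m * 'I_m] (iota 1 (m ^ 2)).

(* For q prime, the elements of 'F_q are the ordinals below q, so that the   *)
(* coercion to nat is the representative N in {0, ..., q-1}; see N_residue   *)
(* and N_lt below.                                                           *)
Definition N (q : nat) (x : 'F_q) : nat := nat_of_ord x.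

Definition Nvec (q m : nat) (a : 'cV['F_q]_m) : nat :=
  (1 + \sum_(j < m) q ^ j * N (a j ord0))%N.

(* Indices start at 0: row i, column j is the (i+1, j+1) entry, so the last  *)
(* row is i = 2n-1 and the last column is j = n-1.  In ring_scope x ^+ 0 = 1 *)
(* also for x = 0.                                                           *)
Definition matA (q n : nat) : 'M['F_q]_(n + n, n) :=
  \matrix_(i < n + n, j < n)
    if (i < (2 * n).-1)%N then (i%:R : 'F_q) ^+ j
    else if j == n.-1 :> nat then 1 else 0.

Definition matB (q n : nat) : 'M['F_q]_(n + n, n) :=
  col_mx (2%:R *: usubmx (matA q n)) ((- 2%:R) *: dsubmx (matA q n)).

Definition matX (q n : nat) : 'M['F_q]_(n + n, n + n) :=
  row_mx (matA q n) (matB q n).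

(* Nvec takes values in {1, ..., q ^ n}, whence the shift of the indices.    *)
(* By square_of_exists_unique below, for q prime this determines M.          *)
Definition is_square_of (q n : nat) (t : 'cV['F_q]_(n + n))
    (M : 'M[nat]_(q ^ n)) : Prop :=
  forall (a b : 'cV['F_q]_n) (i j : 'I_(q ^ n)),
    i.+1 = Nvec a -> j.+1 = Nvec b ->
    M i j = Nvec (matX q n *m col_mx a b + t).

Lemma N_residue (q i : nat) : prime q -> (i < q)%N -> N (i%:R : 'F_q) = i.
Proof. by move=> qP iq; rewrite /N val_Fp_nat // modn_small. Qed.

Lemma N_lt (q : nat) (x : 'F_q) : prime q -> (N x < q)%N.
Proof. by move=> qP; rewrite /N -[X in (_ < X)%N](Fp_cast qP) ltn_ord. Qed.

Lemma digits_lt (q m : nat) (f : 'I_m -> nat) :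
  (forall j, (f j < q)%N) -> (\sum_(j < m) q ^ j * f j < q ^ m)%N.
Proof.
elim: m f => [|m IHm] f fq; first by rewrite big_ord0.
rewrite big_ord_recr /= expnSr.
have q0 : (0 < q)%N by apply: leq_ltn_trans (fq ord_max).
apply: (@leq_trans (q ^ m * (f ord_max).+1)); last by rewrite leq_mul2l fq orbT.
by rewrite mulnS ltn_add2r (IHm (fun j => f (widen_ord (leqnSn m) j))).
Qed.

Lemma digits_inj (q m : nat) (f g : 'I_m -> nat) :
  (forall j, (f j < q)%N) -> (forall j, (g j < q)%N) ->
  (\sum_(j < m) q ^ j * f j)%N = (\sum_(j < m) q ^ j * g j)%N -> f =1 g.
Proof.
elim: m f g => [|m IHm] f g fq gq; first by move=> _ [].
have q0 : (0 < q)%N by apply: leq_ltn_trans (fq ord0).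
have shift (h : 'I_m.+1 -> nat) : (\sum_(j < m.+1) q ^ j * h j)%N =
    ((\sum_(j < m) q ^ j * h (lift ord0 j)) * q + h ord0)%N.
  rewrite big_ord_recl mul1n addnC big_distrl /=; congr (_ + _)%N.
  by apply: eq_bigr => j _; rewrite expnSr mulnAC.
rewrite !shift => E.
have E0 : f ord0 = g ord0.
  by have := congr1 (modn^~ q) E; rewrite !modnMDl !modn_small.
have E1 : (\sum_(j < m) q ^ j * f (lift ord0 j))%N =
          (\sum_(j < m) q ^ j * g (lift ord0 j))%N.
  by move/eqP: E; rewrite E0 eqn_add2r eqn_pmul2r // => /eqP.
move=> j; case: (unliftP ord0 j) => [k|] -> //.
by apply: (IHm (fun k => f (lift ord0 k)) (fun k => g (lift ord0 k))).
Qed.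

Lemma Nvec_bij (q m : nat) : prime q ->
  exists2 idx : 'cV['F_q]_m -> 'I_(q ^ m),
    bijective idx & forall a, (idx a).+1 = Nvec a.
Proof.
move=> qP.
have lt (a : 'cV['F_q]_m) : (\sum_(j < m) q ^ j * N (a j ord0) < q ^ m)%N.
  by apply: digits_lt => j; apply: N_lt.
exists (fun a : 'cV['F_q]_m => Ordinal (lt a)) => //.
apply: inj_card_bij; last by rewrite card_ord card_mx card_Fp // muln1.
move=> a b [] /digits_inj E; apply/matrixP => i j; rewrite ord1.
by apply: val_inj; apply: E => k; apply: N_lt.
Qed.

Lemma square_of_exists_unique (q n : nat) (t : 'cV['F_q]_(n + n)) :
  prime q -> exists! M : 'M[nat]_(q ^ n), is_square_of t M.
Proof.
move=> qP; have [idx [inv idxK invK] idxE] := Nvec_bij n qP.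
exists (\matrix_(i, j) Nvec (matX q n *m col_mx (inv i) (inv j) + t)); split.
  move=> a b i j; rewrite -!idxE => - [/val_inj ->] [/val_inj ->].
  by rewrite mxE !idxK.
move=> M HM; apply/matrixP => i j; rewrite mxE.
by rewrite (HM (inv i) (inv j)) // -idxE invK.
Qed.

(* Main.v *)
(* Any n rows of A are independent: A is the generator matrix of an extended
   Reed-Solomon code.  Scaling the top half and the bottom half of A by nonzero
   constants preserves this, and rows, columns and the two diagonals of M are
   read off as C a + s with C equal to B, A, A + B = (3P; -Q) and
   A - B = (-P; 3Q); on the antidiagonal b = (-1, ..., -1) - a.  For such C, any
   n coordinates of C a + s are jointly uniform as a varies, and the d-th power
   of Nvec expands into functions of at most d <= n coordinates, so the power
   sums depend neither on C nor on s.  M is normal since X is invertible, its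
   determinant being that of P times that of Q times a power of -4. *)

Require Import Defs.
From mathcomp Require Import all_boot all_order all_algebra.

Set Implicit Arguments.
Unset Strict Implicit.
Unset Printing Implicit Defensive.

Import GRing.Theory.
Local Open Scope ring_scope.

(** * Matrices with freely prescribable coordinates, and their power sums *)

(** For [n <= m] this says that any [n] rows of [C] are independent, the MDS property. *)
Definition interpolates (F : fieldType) (m n : nat) (C : 'M[F]_(m, n)) : Prop :=
  forall (S : {set 'I_m}) (u : 'cV[F]_m), (#|S| <= n)%N ->
  exists a : 'cV[F]_n, {in S, forall i, (C *m a) i 0 = u i 0}.

(** Enlarge [S] to exactly [n] rows; the square submatrix on these rows has trivial kernel, so it is
    invertible. *)
Lemma interpolates_of_ker (F : fieldType) (m n : nat) (C : 'M[F]_(m, n)) :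
  (n <= m)%N ->
  (forall (S : {set 'I_m}) (a : 'cV[F]_n), #|S| = n ->
     {in S, forall i, (C *m a) i 0 = 0} -> a = 0) ->
  interpolates C.
Proof.
move=> le_nm kerC S u; have [k] := ubnPeq (n - #|S|)%N.
elim: k S => [|k IHk] S Ek leSn; last first.
  have [i iS] : exists i, i \notin S.
    apply/existsP; rewrite -negb_forall; apply/negP => /forallP allS.
    have : #|S| = m by rewrite -[RHS]card_ord; apply: eq_card => i; rewrite allS.
    by move=> Em; move: Ek; rewrite Em (eqP le_nm).
  have cS : #|i |: S| = #|S|.+1 by rewrite cardsU1 iS.
  have [||a Ha] := IHk (i |: S); rewrite ?cS.
  - by rewrite subnS (eqP Ek).
  - by rewrite -subn_gt0 (eqP Ek).
  by exists a => j jS; apply: Ha; rewrite inE jS orbT.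
have cS : #|S| = n by apply/eqP; rewrite eqn_leq leSn -subn_eq0.
subst n; pose D := rowsub (@enum_val _ (mem S)) C.
have DE a k : (D *m a) k 0 = (C *m a) (enum_val k) 0.
  by rewrite !mxE; apply: eq_bigr => j _; rewrite mxE.
have Du : D \in unitmx.
  (* A row killed by [D^T] is the transpose of a vector killed by the rows of [C] in [S]. *)
  rewrite -unitmx_tr -row_free_unit; apply: inj_row_free => v Dv.
  rewrite -[v]trmxK [v^T](kerC S _ (erefl _)) ?trmx0 // => i iS.
  have : D *m v^T = 0 by rewrite -[D]trmxK -trmx_mul Dv trmx0.
  move/matrixP/(_ (enum_rank_in iS i) 0).
  by rewrite DE enum_rankK_in // => ->; rewrite mxE.
exists (invmx D *m (\col_k u (enum_val k) 0)) => i iS.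
by rewrite -{1}(enum_rankK_in iS iS) -DE mulKVmx // mxE enum_rankK_in.
Qed.

(* [g] may depend on the coordinates in [S] only; translating [t] within those
   coordinates is absorbed by a translation of [a], so the sum does not depend
   on [t], and averaging it over all [t] gives the right-hand side. *)
Lemma sum_interpolates (F : finFieldType) (m n : nat) (C : 'M[F]_(m, n))
    (S : {set 'I_m}) (g : 'cV[F]_m -> nat) (t : 'cV[F]_m) :
  interpolates C -> (#|S| <= n)%N ->
  (forall v w : 'cV[F]_m, {in S, forall i, v i 0 = w i 0} -> g v = g w) ->
  (#|F| ^ m * \sum_(a : 'cV[F]_n) g (C *m a + t)%R =
   #|F| ^ n * \sum_(w : 'cV[F]_m) g w)%N.
Proof.
move=> intC leSn gS.
transitivity (\sum_(s : 'cV[F]_m) \sum_(a : 'cV[F]_n) g (C *m a + s)%R)%N.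
  transitivity (\sum_(s : 'cV[F]_m) \sum_(a : 'cV[F]_n) g (C *m a + t)%R)%N.
    by rewrite sum_nat_const card_mx muln1.
  apply: eq_bigr => s _; have [a0 Ha0] := intC S (s - t) leSn.
  rewrite (reindex_inj (addrI a0)) /=; apply: eq_bigr => a _.
  apply: gS => i iS; rewrite mulmxDr !(mxE, Ha0) //.
  have := Ha0 i iS; rewrite !mxE => ->.
  by rewrite addrAC subrK addrC.
(* For fixed [a], the vector [C *m a + s] runs over the whole space as [s] does. *)
rewrite exchange_big /= (eq_bigr (fun=> \sum_w g w)%N) => [|a _].
  by rewrite sum_nat_const card_mx muln1.
by rewrite [RHS](reindex_inj (addrI (C *m a))).
Qed.

(* Expanding one factor [Nvec] of the power fixes one more coordinate. *)
Lemma sum_interpolates_Nvec (q m n d : nat) (C : 'M['F_q]_(m, n))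
    (S : {set 'I_m}) (g : 'cV['F_q]_m -> nat) (t : 'cV['F_q]_m) :
  interpolates C -> (#|S| + d <= n)%N ->
  (forall v w : 'cV['F_q]_m, {in S, forall i, v i 0 = w i 0} -> g v = g w) ->
  (#|'F_q| ^ m * \sum_(a : 'cV['F_q]_n)
      g (C *m a + t)%R * Nvec (C *m a + t)%R ^ d =
   #|'F_q| ^ n * \sum_(w : 'cV['F_q]_m) g w * Nvec w ^ d)%N.
Proof.
move=> intC; elim: d S g => [|d IHd] S g leSn gS.
  rewrite (sum_interpolates (S := S) (g := fun w => g w * Nvec w ^ 0)%N) //.
    by rewrite addn0 in leSn.
  by move=> v w /gS ->.
have expand (w : 'cV['F_q]_m) : (g w * Nvec w ^ d.+1 =
    g w * Nvec w ^ d +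
    \sum_(j < m) (g w * (q ^ j * N (w j ord0))) * Nvec w ^ d)%N.
  rewrite expnS {1}/Nvec mulnDl mul1n mulnDr; congr (_ + _)%N.
  rewrite big_distrl big_distrr /=; apply: eq_bigr => j _.
  by rewrite mulnA.
under eq_bigr do rewrite expand; under [in RHS]eq_bigr do rewrite expand.
rewrite !big_split !mulnDr /=; congr (_ + _)%N.
  by apply: (IHd S) => //; apply: leq_trans leSn; rewrite addnS leqnSn.
rewrite exchange_big [in RHS]exchange_big /= !big_distrr /=.
apply: eq_bigr => j _.
(* The digit joins the weight: [S] gains at most one coordinate while the exponent drops by one. *)
apply: (IHd (j |: S) (fun w => g w * (q ^ j * N (w j ord0)))%N).
  apply: leq_trans leSn; rewrite addnS -addSn leq_add2r cardsU1.
  by case: (j \notin S) => //; rewrite leqnSn.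
move=> v w E; rewrite (E j) ?setU11 // (gS v w) // => i iS.
by apply: E; rewrite inE iS orbT.
Qed.

(** All interpolating matrices of one size share their power sums, as [C] and [t] are absent on the
    right; the powers of [#|'F_q|] avoid division. *)
Lemma sum_Nvec_expn (q m n d : nat) (C : 'M['F_q]_(m, n)) (t : 'cV['F_q]_m) :
  interpolates C -> (d <= n)%N ->
  (#|'F_q| ^ m * \sum_(a : 'cV['F_q]_n) Nvec (C *m a + t)%R ^ d =
   #|'F_q| ^ n * \sum_(w : 'cV['F_q]_m) Nvec w ^ d)%N.
Proof.
move=> intC dn.
have := @sum_interpolates_Nvec q m n d C set0 (fun=> 1%N) t intC.
rewrite cards0 => /(_ dn) E; under eq_bigr do rewrite -[(_ ^ d)%N]mul1n.
by rewrite E //; under eq_bigr do rewrite mul1n.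
Qed.

(** * Independence of the rows of [matA] *)

Lemma natr_Fp_inj (q i j : nat) : prime q -> (i < q)%N -> (j < q)%N ->
  i%:R = j%:R :> 'F_q -> i = j.
Proof. by move=> qP iq jq /(congr1 (@N q)); rewrite !N_residue. Qed.

(* The entries of [A a] are the values at 0, ..., 2n-2 of the polynomial with
   coefficients [a], together with its coefficient of degree n-1. *)
Lemma matA_ker (q n : nat) (S : {set 'I_(n + n)}) (a : 'cV['F_q]_n) :
  prime q -> (2 * n - 1 <= q)%N -> #|S| = n ->
  {in S, forall i, (matA q n *m a) i 0 = 0} -> a = 0.
Proof.
move=> qP qn cS Ha.
case: n => [|n] in S a qn cS Ha *; first by apply/matrixP => - [].
have coefp (j : 'I_n.+1) : (rVpoly a^T)`_j = a j 0.
  by rewrite coef_rVpoly_ord mxE.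
set p := rVpoly a^T in coefp.
suff p0 : p = 0.
  by apply/matrixP => j k; rewrite ord1 mxE -coefp p0 coef0.
have sp : (size p <= n.+1)%N by apply: size_poly.
have horn (i : 'I_(n.+1 + n.+1)) : (i < (2 * n.+1).-1)%N ->
    p.[i%:R] = (matA q n.+1 *m a) i 0.
  move=> lti; rewrite (horner_coef_wide _ sp) mxE.
  by apply: eq_bigr => j _; rewrite coefp mxE lti mulrC.
have lastE : (2 * n.+1).-1 = (n + n.+1)%N by rewrite mul2n -addnn.
have lead : (matA q n.+1 *m a) ord_max 0 = p`_n.
  rewrite mxE (bigD1 ord_max) //= big1 => [|j jn].
    by rewrite addr0 mxE lastE /= ltnn eqxx mul1r (coefp ord_max).
  rewrite mxE lastE /= ltnn.
  by case: eqP => [E|]; [case/eqP: jn; apply: val_inj|rewrite mul0r].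
pose T := S :\ ord_max; pose rs : seq 'F_q := [seq i%:R | i : 'I__ in T].
have T_lt (i : 'I_(n.+1 + n.+1)) : i \in T -> (i < (2 * n.+1).-1)%N.
  rewrite !inE => /andP[iN _]; rewrite lastE ltn_neqAle.
  by rewrite -ltnS ltn_ord andbT; apply: contra iN => /eqP E; apply/eqP/val_inj.
(* The evaluation points are integers below [q], hence distinct in ['F_q]. *)
have rs_uniq : uniq rs.
  apply/dinjectiveP => i j iT jT /natr_Fp_inj E; apply/val_inj/E => //.
    by apply: leq_trans (T_lt i iT) _; rewrite -subn1.
  by apply: leq_trans (T_lt j jT) _; rewrite -subn1.
have rs_root : all (root p) rs.
  apply/allP => _ /imageP[i iT ->]; rewrite rootE horn ?T_lt //.
  by rewrite Ha //; case/setD1P: iT.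
(* [T] has [n.+1] elements, or [n] when [S] contains the last row; in that case the coefficient of
   degree [n] vanishes too, so [p] has size at most [n]. *)
have le_p_rs : (size p <= size rs)%N.
  rewrite size_image; have := cardsD1 ord_max S; rewrite cS -/T.
  case: (boolP (ord_max \in S)) => [maxS | _]; last by rewrite add0n => <-.
  rewrite add1n => -[<-].
  apply/leq_sizeP => j; rewrite leq_eqVlt => /predU1P[<-|jn].
    by rewrite -lead Ha.
  by rewrite nth_default // (leq_trans sp).
apply/eqP/negPn/negP => /max_poly_roots/(_ rs_root rs_uniq).
by rewrite ltnNge le_p_rs.
Qed.

Lemma matA_interpolates (q n : nat) : prime q -> (2 * n - 1 <= q)%N ->
  interpolates (matA q n).
Proof.
move=> qP qn; apply: interpolates_of_ker; first exact: leq_addr.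
by move=> S a; apply: matA_ker.
Qed.

(** * Invertibility of [matX], and the matrices of rows, columns and diagonals *)

(** Dividing the two halves of the target by [x] and [y] reduces to [C]. *)
Lemma interpolates_scale (F : fieldType) (n1 n2 n : nat)
    (C : 'M[F]_(n1 + n2, n)) (x y : F) :
  x != 0 -> y != 0 -> interpolates C ->
  interpolates (col_mx (x *: usubmx C) (y *: dsubmx C)).
Proof.
move=> x0 y0 intC S u leSn.
have [a Ha] := intC S (col_mx (x^-1 *: usubmx u) (y^-1 *: dsubmx u)) leSn.
exists a => i iS; move: (Ha i iS).
rewrite -{1}[C]vsubmxK !mul_col_mx -!scalemxAl -{3}[u]vsubmxK.
case: (split_ordP i) => j ->; rewrite ?col_mxEu ?col_mxEd => E.
  by rewrite mxE E mxE mulVKf.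
by rewrite mxE E mxE mulVKf.
Qed.

Lemma usubmx_matA_ker (q n : nat) (a : 'cV['F_q]_n) :
  prime q -> (2 * n - 1 <= q)%N -> usubmx (matA q n) *m a = 0 -> a = 0.
Proof.
move=> qP qn Pa; apply: (@matA_ker q n [set lshift n i | i : 'I_n]) => //.
  by rewrite card_imset ?card_ord //; apply: lshift_inj.
move=> _ /imsetP[i _ ->].
by rewrite -[matA q n]vsubmxK mul_col_mx col_mxEu Pa mxE.
Qed.

Lemma dsubmx_matA_ker (q n : nat) (a : 'cV['F_q]_n) :
  prime q -> (2 * n - 1 <= q)%N -> dsubmx (matA q n) *m a = 0 -> a = 0.
Proof.
move=> qP qn Qa; apply: (@matA_ker q n [set rshift n i | i : 'I_n]) => //.
  by rewrite card_imset ?card_ord //; apply: rshift_inj.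
move=> _ /imsetP[i _ ->].
by rewrite -[matA q n]vsubmxK mul_col_mx col_mxEd Qa mxE.
Qed.

Lemma natr_Fp_neq0 (q k : nat) : prime q -> (0 < k < q)%N -> k%:R != 0 :> 'F_q.
Proof.
move=> qP /andP[k0 kq]; apply: contraTneq k0 => /(@natr_Fp_inj q k 0 qP kq) ->//.
exact: prime_gt0.
Qed.

Lemma mul_matX (q n : nat) (a b : 'cV['F_q]_n) :
  matX q n *m col_mx a b = matA q n *m a + matB q n *m b.
Proof. exact: mul_row_col. Qed.

(** For a kernel vector [(a, b)], the trivial kernels of the two halves of [matA] give [a + 2b = 0]
    and [a - 2b = 0], so [4b = 0], and 4 is nonzero because [4 < q]. *)
Lemma matX_inj (q n : nat) : prime q -> (2 * n - 1 <= q)%N -> (4 < q)%N ->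
  injective (mulmx (matX q n) : 'cV_(n + n) -> 'cV_(n + n)).
Proof.
move=> qP qn q4 v w /eqP; rewrite -subr_eq0 -mulmxBr => /eqP.
suff ker (u : 'cV['F_q]_(n + n)) : matX q n *m u = 0 -> u = 0.
  by move/ker/eqP; rewrite subr_eq0 => /eqP.
rewrite -[u]vsubmxK; move: (usubmx u) (dsubmx u) => a b.
rewrite mul_matX -{1}[matA q n]vsubmxK !mul_col_mx add_col_mx => /eqP.
rewrite col_mx_eq0 -!scalemxAl !scalemxAr -!mulmxDr => /andP[/eqP Pab /eqP Qab].
have {}Pab := usubmx_matA_ker qP qn Pab; have {}Qab := dsubmx_matA_ker qP qn Qab.
have b0 : b = 0.
  have : 4%:R *: b = 0.
    rewrite -(subrr (0 : 'cV['F_q]_n)) -{1}Pab -Qab addrAC opprD addrA subrr add0r.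
    by rewrite scaleNr opprK addrC -scalerDl -natrD.
  by move/eqP; rewrite scaler_eq0 (negPf (natr_Fp_neq0 qP _)) ?q4 // => /eqP.
by move: Pab; rewrite b0 scaler0 addr0 => ->; rewrite col_mx0.
Qed.

Lemma matB_interpolates (q n : nat) : prime q -> (2 * n - 1 <= q)%N ->
  (4 < q)%N -> interpolates (matB q n).
Proof.
move=> qP qn q4; have q2 : 2%:R != 0 :> 'F_q.
  by rewrite natr_Fp_neq0 //= (ltn_trans _ q4).
by apply: interpolates_scale; rewrite ?oppr_eq0 //; apply: matA_interpolates.
Qed.

Lemma matAB_interpolates (q n : nat) : prime q -> (2 * n - 1 <= q)%N -> (4 < q)%N ->
  interpolates (matA q n + matB q n).
Proof.
move=> qP qn q4; have -> : matA q n + matB q n =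
    col_mx (3%:R *: usubmx (matA q n)) (- 1 *: dsubmx (matA q n)).
  rewrite -{1}[matA q n]vsubmxK add_col_mx; congr col_mx.
    by rewrite -{1}[usubmx _]scale1r -scalerDl -(natrD _ 1 2).
  rewrite -{1}[dsubmx _]scale1r -scalerDl; congr (_ *: _).
  by rewrite mulr2n opprD addrA subrr add0r.
apply: interpolates_scale; last exact: matA_interpolates.
  by rewrite natr_Fp_neq0 //= (ltn_trans _ q4).
by rewrite oppr_eq0 oner_eq0.
Qed.

Lemma matA_subB_interpolates (q n : nat) :
  prime q -> (2 * n - 1 <= q)%N -> (4 < q)%N ->
  interpolates (matA q n - matB q n).
Proof.
move=> qP qn q4; have -> : matA q n - matB q n =
    col_mx (- 1 *: usubmx (matA q n)) (3%:R *: dsubmx (matA q n)).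
  rewrite -{1}[matA q n]vsubmxK opp_col_mx add_col_mx; congr col_mx.
    rewrite -{1}[usubmx _]scale1r -scaleNr -scalerDl; congr (_ *: _).
    by rewrite mulr2n opprD addrA subrr add0r.
  by rewrite -{1}[dsubmx _]scale1r -scaleNr opprK -scalerDl -(natrD _ 1 2).
apply: interpolates_scale; last exact: matA_interpolates.
  by rewrite oppr_eq0 oner_eq0.
by rewrite natr_Fp_neq0 //= (ltn_trans _ q4).
Qed.

(** * Reflection of indices *)

(** The sum plus one is divisible by [q] and lies strictly between 0 and [2q]. *)
Lemma N_reflect (q : nat) (x : 'F_q) : prime q -> (N x + N (- 1 - x)%R = q.-1)%N.
Proof.
move=> qP; have NK (y : 'F_q) : (N y)%:R = y by apply: natr_Zp.
have /(_ (N x + N (- 1 - x)%R).+1) := dvdn_pcharf (pchar_Fp qP).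
rewrite -addn1 !natrD !NK (addrCA x) subrr addr0 addNr eqxx addn1.
have := N_lt x qP; have := N_lt (- 1 - x) qP; set y := N x; set z := N _.
move=> zq yq /dvdnP[[|[|k]] E]; first by [].
  by rewrite -[(y + z)%N]/((y + z).+1.-1) E mul1n.
have : ((y + z).+1 < q + q)%N by rewrite -addnS -addSn leq_add.
by rewrite E !mulSn addnA ltnNge leq_addr.
Qed.

(** Reflection acts digit by digit; digits all equal to [q.-1] give [q ^ m - 1], and the two leading
    ones of [Nvec] add 2. This locates the antidiagonal. *)
Lemma Nvec_reflect (q m : nat) (a : 'cV['F_q]_m) : prime q ->
  (Nvec a + Nvec (const_mx (- 1) - a)%R = (q ^ m).+1)%N.
Proof.
move=> qP; rewrite /Nvec addnACA -big_split /=.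
have E : (\sum_(j < m) q ^ j * q.-1).+1 = (q ^ m)%N.
  elim: (m) => [|k IHk]; first by rewrite big_ord0.
  by rewrite big_ord_recr /= -addSn IHk -mulnS prednK ?prime_gt0 // expnSr.
rewrite -E; congr _.+2; apply: eq_bigr => j _.
by rewrite -mulnDr !mxE N_reflect.
Qed.

Lemma Nvec_inj (q m : nat) : prime q -> injective (@Nvec q m).
Proof.
move=> qP a b; have [idx /bij_inj idx_inj idxE] := Nvec_bij m qP.
by rewrite -!idxE => -[/val_inj/idx_inj].
Qed.

Lemma Nvec_bounds (q m : nat) (a : 'cV['F_q]_m) : prime q ->
  (1 <= Nvec a <= q ^ m)%N.
Proof.
by move=> qP; have [idx _ idxE] := Nvec_bij m qP; rewrite -idxE ltn_ord.
Qed.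

(** * Normality and equal power sums *)

(** The entries are distinct by injectivity of [matX], and they are as many as the integers in the
    interval that contains them. *)
Lemma square_normal (n q : nat) (t : 'cV['F_q]_(n + n))
    (M : 'M[nat]_(q ^ n)) :
  prime q -> (2 * n - 1 <= q)%N -> (4 < q)%N -> is_square_of t M -> normal_matrix M.
Proof.
move=> qP qn q4 HM.
have [idx [inv idxK invK] idxE] := Nvec_bij n qP.
have ME i j : M i j = Nvec (matX q n *m col_mx (inv i) (inv j) + t).
  by apply: HM; rewrite -idxE invK.
rewrite /normal_matrix; set s := (X in perm_eq X _).
have s_uniq : uniq s.
  apply/injectiveP => -[i j] [i' j'] /=; rewrite !ME => /(Nvec_inj qP)/addIr.
  move/(matX_inj qP qn q4)/eq_col_mx => [/(can_inj invK) -> /(can_inj invK) ->].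
  by [].
have s_sub : {subset s <= iota 1 ((q ^ n) ^ 2)}.
  move=> _ /imageP[[i j] _ ->]; rewrite mem_iota add1n ltnS -expnM muln2 -addnn.
  by rewrite ME Nvec_bounds.
have s_size : size s = ((q ^ n) ^ 2)%N.
  by rewrite size_image card_prod !card_ord.
apply: uniq_perm => //; first exact: iota_uniq.
by apply: (uniq_min_size s_uniq s_sub _).2; rewrite size_iota s_size.
Qed.

Lemma square_multimagic (n q : nat) (t : 'cV['F_q]_(n + n))
    (M : 'M[nat]_(q ^ n)) :
  prime q -> (2 * n - 1 <= q)%N -> (4 < q)%N -> is_square_of t M ->
  multimagic_square n M.
Proof.
move=> qP qn q4 HM d /andP[_ dn].
have [idx idx_bij idxE] := Nvec_bij n qP.
have [inv idxK invK] := idx_bij.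
have ME a b : M (idx a) (idx b) = Nvec (matX q n *m col_mx a b + t).
  by apply: HM; rewrite -idxE.
have sum_idx (f : 'I_(q ^ n) -> nat) :
    (\sum_i f i = \sum_(a : 'cV['F_q]_n) f (idx a))%N.
  by apply: reindex; apply: onW_bij.
exists (\sum_(a : 'cV['F_q]_n) Nvec (matA q n *m a)%R ^ d)%N.
(* Rows, columns and both diagonals give sums of this shape, with any fixed index absorbed in
   [s]. *)
have sumE (C : 'M['F_q]_(n + n, n)) s : interpolates C ->
    (\sum_(a : 'cV['F_q]_n) Nvec (C *m a + s)%R ^ d =
     \sum_(a : 'cV['F_q]_n) Nvec (matA q n *m a)%R ^ d)%N.
  move=> intC; apply/eqP.
  have q0 : (0 < #|'F_q| ^ (n + n))%N by rewrite expn_gt0 card_Fp // prime_gt0.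
  rewrite -(eqn_pmul2l q0) (sum_Nvec_expn s intC dn).
  rewrite -(sum_Nvec_expn 0 (matA_interpolates qP qn) dn).
  by under eq_bigr do rewrite addr0.
split=> [i|j||].
- rewrite sum_idx -[i]invK.
  rewrite -(sumE _ (matA q n *m inv i + t) (matB_interpolates qP qn q4)).
  by apply: eq_bigr => b _; rewrite mxE ME mul_matX addrCA addrA.
- rewrite sum_idx -[j]invK.
  rewrite -(sumE _ (matB q n *m inv j + t) (matA_interpolates qP qn)).
  by apply: eq_bigr => a _; rewrite mxE ME mul_matX addrA.
- rewrite sum_idx -(sumE _ t (matAB_interpolates qP qn q4)).
  by apply: eq_bigr => a _; rewrite mxE ME mul_matX mulmxDl.
rewrite sum_idx -(sumE _ (matB q n *m const_mx (- 1) + t)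
                         (matA_subB_interpolates qP qn q4)).
(* Indices are one less than [Nvec], so reversal sends [Nvec a] to [q ^ n + 1 - Nvec a]. *)
apply: eq_bigr => a _; have -> : rev_ord (idx a) = idx (const_mx (- 1) - a).
  apply: val_inj; rewrite /= idxE; apply: succn_inj; rewrite idxE.
  have /andP[_ le_a] := Nvec_bounds a qP.
  by rewrite -subSn // -(Nvec_reflect a qP) addKn.
rewrite mxE ME mul_matX mulmxBr mulmxBl.
by rewrite (addrC (matB q n *m const_mx _)) !addrA.
Qed.

Theorem theorem3p4 (n q : nat) (hn : (3 <= n)%N) (hq : prime q)
  (hqn : (2 * n - 1 <= q)%N) (t : 'cV['F_q]_(n + n)) (M : 'M[nat]_(q ^ n))
  (hM : is_square_of t M) :
  normal_matrix M /\ multimagic_square n M.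
Proof.
(* From [n >= 3] one gets [q >= 5], so 2, 3 and 4 are nonzero in ['F_q]. *)
have q4 : (4 < q)%N.
  apply: leq_trans hqn; rewrite leq_subRL ?muln_gt0 ?(leq_trans _ hn) //.
  by rewrite (leq_mul2l 2 3).
by split; [apply: square_normal hM|apply: square_multimagic hM].
Qed.
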